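(* Let $n\ge 1$ and let $(X_t)_{t\ge 0}$ be a finite spin system on $\{0,1\}^n$ with rate functions $\lambda_i,\mu_i$, $i=1,\dots,n$. Suppose that $\lambda_i$ and $\mu_i$ are extended from $\{0,1\}^n$ to functions $[0,1]^n\to\mathbb{R}_+$ such that, on $[0,1]^n$, for every $i$: $\lambda_i$ is increasing and concave, $\mu_i$ is decreasing and convex, and $\lambda_i+\mu_i$ is increasing. Let $p_t=(p_{1,t},\dots,p_{n,t})\in[0,1]^n$, $t\ge0$, be the solution to the system of ordinary differential equations $$p_{i,t}'=(1-p_{i,t})\,\lambda_i(p_t)-p_{i,t}\,\mu_i(p_t),\qquad i=1,\dots,n,$$ where $'$ denotes the derivative in $t$. If $p_{i,0}=X_{i,0}$ for all $i$, then $\mathbb{E}_0X_{i,t}\le p_{i,t}$ for all $i\in\{1,\dots,n\}$ and all real $t\ge0$.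
   Context: Finite spin system: given functions $\lambda_i,\mu_i:\{0,1\}^n\to\mathbb{R}_+=[0,\infty)$, $i=1,\dots,n$, the spin system $X_t=(X_{1,t},\dots,X_{n,t})$ is the continuous time Markov jump process on $\{0,1\}^n$ in which, when the current state is $x$, coordinate $i$ flips from $0$ to $1$ at rate $\lambda_i(x)$ (if $x_i=0$) and from $1$ to $0$ at rate $\mu_i(x)$ (if $x_i=1$), for each $i$; only one coordinate changes at each jump. $\mathbb{E}_0$ denotes expectation conditioned on the initial state $X_0$ (equivalently, expectation for the process started from a fixed deterministic $X_0\in\{0,1\}^n$). A function $f$ on $[0,1]^n$ is increasing (decreasing) if $f(x)\le f(y)$ (respectively $f(x)\ge f(y)$) whenever $x_j\le y_j$ for all $j$; monotonicity is in the weak sense. *)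

(* Defs.v *)
From HB Require Import structures.
From mathcomp Require Import all_boot all_order all_algebra.
From mathcomp Require Import all_classical all_reals all_analysis.

Set Implicit Arguments.
Unset Strict Implicit.
Unset Printing Implicit Defensive.

Import Order.TTheory GRing.Theory Num.Theory.
Import numFieldNormedType.Exports.

Local Open Scope classical_set_scope.
Local Open Scope ring_scope.

(** Monotonicity and convexity on the unit cube *)

Definition unit_cube (R : realType) (n : nat) : set 'rV[R]_n :=
  [set x | forall j, 0 <= x ord0 j <= 1].

Definition increasing_on_cube (R : realType) (n : nat) (f : 'rV[R]_n -> R) :=
  forall x y, unit_cube x -> unit_cube y ->
    (forall j, x ord0 j <= y ord0 j) -> f x <= f y.

Definition decreasing_on_cube (R : realType) (n : nat) (f : 'rV[R]_n -> R) :=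
  forall x y, unit_cube x -> unit_cube y ->
    (forall j, x ord0 j <= y ord0 j) -> f y <= f x.

Definition convex_on_cube (R : realType) (n : nat) (f : 'rV[R]_n -> R) :=
  convex_function (@unit_cube R n) f.

Definition concave_on_cube (R : realType) (n : nat) (f : 'rV[R]_n -> R) :=
  convex_on_cube (fun x => - f x).

(** Continuous-time Markov jump processes on a finite state space *)

(* Only the off-diagonal values of [r] are used; the diagonal of the
   generator is determined by the vanishing of row sums. *)
Definition generator (R : realType) (S : finType) (r : S -> S -> R)
    (x y : S) : R :=
  if x == y then - \sum_(z | z != x) r x z else r x y.

Record is_transition_semigroup (R : realType) (S : finType)
    (r : S -> S -> R) (K : R -> S -> S -> R) : Prop := {
  semigroup_ge0 : forall (t : R) x y, 0 <= t -> 0 <= K t x y ;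
  semigroup_sum1 : forall (t : R) x, 0 <= t -> \sum_y K t x y = 1 ;
  semigroup_id : forall x y, K 0 x y = (x == y)%:R ;
  semigroup_comp : forall (s t : R) x y, 0 <= s -> 0 <= t ->
    K (s + t) x y = \sum_z K s x z * K t z y ;
  semigroup_gen : forall x y,
    h^-1 * (K h x y - K 0 x y) @[h --> 0^'+] --> generator r x y
}.

Section Processes.
Context (R : realType) (d : measure_display) (T : measurableType d).
Context (P : probability T R) (S : finType).

Definition past (X : R -> T -> S) (t : R) : set (set T) :=
  <<s [set B | exists s x, 0 <= s <= t /\ B = X s @^-1` [set x]] >>.

(* Processes are indexed by all of [R], but only times [0 <= t] matter. The
   Markov property P(X_(t+h) = y | past, X_t = x) = K h x y is written in
   product form, so that null events need no special treatment. *)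
Record is_markov_jump_process (r : S -> S -> R) (X : R -> T -> S) : Prop := {
  mjp_measurable : forall (t : R) x, 0 <= t -> measurable (X t @^-1` [set x]) ;
  mjp_right_continuous : {ae P, forall w, forall t : R, 0 <= t ->
    \forall s \near t^'+, X s w = X t w} ;
  mjp_left_limits : {ae P, forall w, forall t : R, 0 < t ->
    exists x, \forall s \near t^'-, X s w = x} ;
  mjp_markov : exists2 K, is_transition_semigroup r K &
    forall (t h : R) A x y, 0 <= t -> 0 <= h -> past X t A ->
      P (A `&` X t @^-1` [set x] `&` X (t + h) @^-1` [set y]) =
      (P (A `&` X t @^-1` [set x]) * (K h x y)%:E)%E
}.

(* Meaningful when [A] has positive probability. *)
Definition cond_expectation (A : set T) (f : T -> R) : R :=
  fine ('E_P[fun w => (f w * \1_A w)%R])%E / fine (P A).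

End Processes.

(** Finite spin systems *)

Definition config (n : nat) := {ffun 'I_n -> bool}.

Definition vertex (R : realType) (n : nat) (x : config n) : 'rV[R]_n :=
  \row_j (x j)%:R.

Definition flip (n : nat) (x : config n) (i : 'I_n) : config n :=
  [ffun j => if j == i then ~~ x j else x j].

Definition spin_rate (R : realType) (n : nat)
    (lambda mu : 'I_n -> config n -> R) (x y : config n) : R :=
  \sum_(i | y == flip x i) (if x i then mu i x else lambda i x).

Definition is_spin_system (R : realType) (n : nat) (d : measure_display)
    (T : measurableType d) (P : probability T R)
    (lambda mu : 'I_n -> config n -> R) (X : R -> T -> config n) : Prop :=
  is_markov_jump_process P (spin_rate lambda mu) X.

Definition mean_field_drift (R : realType) (n : nat)
    (lambda mu : 'I_n -> 'rV[R]_n -> R) (i : 'I_n) (x : 'rV[R]_n) : R :=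
  (1 - x ord0 i) * lambda i x - x ord0 i * mu i x.

(* The equation holds on [0, +oo[, with a one-sided derivative at 0. *)
Record is_mean_field_solution (R : realType) (n : nat)
    (lambda mu : 'I_n -> 'rV[R]_n -> R) (p : R -> 'rV[R]_n) : Prop := {
  mf_cube : forall t : R, 0 <= t -> unit_cube (p t) ;
  mf_ode : forall (t : R) i, 0 < t ->
    is_derive t 1 (fun s => p s ord0 i) (mean_field_drift lambda mu i (p t)) ;
  mf_ode0 : forall i,
    h^-1 * (p h ord0 i - p 0 ord0 i) @[h --> 0^'+]
      --> mean_field_drift lambda mu i (p 0)
}.

(* Main.v *)
Require Import Defs.
From mathcomp Require Import all_boot all_order all_algebra.
From mathcomp Require Import all_classical all_reals all_analysis.
From mathcomp Require Import ring lra.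
Set Implicit Arguments.
Unset Strict Implicit.
Unset Printing Implicit Defensive.

Import Order.TTheory GRing.Theory Num.Theory.
Import numFieldNormedType.Exports.
Local Open Scope classical_set_scope.
Local Open Scope ring_scope.

(** The generator applied to the coordinate [x_i] is
[lambda_i - x_i (lambda_i + mu_i)]. The rates make the spin system attractive and
its jumps change one coordinate at a time, so by Harris' inequality the law at
each time is positively associated: [x_i] and the increasing function
[lambda_i + mu_i] are positively correlated. Together with Jensen's inequality
for [lambda_i] and [mu_i], this gives [q_i' <= b_i(q)] for the mean [q] of the
process, where [b] is the mean-field drift. The drift is cooperative and
subhomogeneous, [b_i(q) <= c b_i(p)] whenever [q <= c p], [q_i = c p_i] and
[c >= 1], so a first-crossing argument compares [q] with the multiples of [p]
without any Lipschitz condition. *)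

(** * Right derivatives *)

(** The derivative is one-sided because the generator is given as a right limit at [0]. Left
    continuity is added so that a nonpositive sign passes to the supremum of times in [barrier]. *)
Record has_right_derivative (R : realType) (g d : R -> R) : Prop := {
  left_continuity : forall t, 0 < t -> g (t - h) @[h --> 0^'+] --> g t ;
  right_derivative : forall t, 0 <= t ->
    h^-1 * (g (t + h) - g t) @[h --> 0^'+] --> d t
}.

Section RightDerivative.
Context (R : realType).
Implicit Types (f g d e : R -> R).

Lemma cvg_id_at_right0 : (h : R) @[h --> 0^'+] --> (0 : R).
Proof. exact: (cvg_at_right_filter cvg_id). Qed.

Lemma right_continuity g d : has_right_derivative g d ->
  forall t, 0 <= t -> g (t + h) @[h --> 0^'+] --> g t.
Proof.
move=> [_ dg] t t0.
have -> : g t = g t + 0 * d t by rewrite mul0r addr0.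
apply: (@cvg_trans _
  ((g t + h * (h^-1 * (g (t + h) - g t))) @[h --> 0^'+])).
  apply: near_eq_cvg; near=> h.
  have h0 : h != 0 by near: h; exact: nbhs_right_neq.
  by rewrite mulrA divff // mul1r addrC subrK.
apply: cvgD; first exact: cvg_cst.
by apply: cvgM; [exact: cvg_id_at_right0 | exact: dg].
Unshelve. all: by end_near. Qed.

Lemma has_right_derivative_cst (c : R) :
  has_right_derivative (fun=> c) (fun=> 0).
Proof.
split=> t _; first exact: cvg_cst.
by under eq_fun do rewrite subrr mulr0; exact: cvg_cst.
Qed.

Lemma has_right_derivative_id :
  has_right_derivative (fun t : R => t) (fun=> 1).
Proof.
split=> t _.
  have {2}-> : t = t - 0 by rewrite subr0.
  by apply: cvgB; [exact: cvg_cst | exact: cvg_id_at_right0].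
apply: (@cvg_trans _ ((fun=> 1 : R) @ (0 : R)^'+)); last exact: cvg_cst.
apply: near_eq_cvg; near=> h.
by rewrite (addrC t) addrK mulVf //; near: h; exact: nbhs_right_neq.
Unshelve. all: by end_near. Qed.

Lemma has_right_derivativeD f g d e :
  has_right_derivative f d -> has_right_derivative g e ->
  has_right_derivative (fun t => f t + g t) (fun t => d t + e t).
Proof.
move=> [lf rf] [lg rg]; split=> t t0.
  by apply: cvgD; [exact: lf | exact: lg].
under eq_fun do rewrite opprD addrACA mulrDr.
by apply: cvgD; [exact: rf | exact: rg].
Qed.

Lemma has_right_derivativeM f g d e :
  has_right_derivative f d -> has_right_derivative g e ->
  has_right_derivative (fun t => f t * g t)
    (fun t => d t * g t + f t * e t).
Proof.
move=> hf hg; split=> t t0.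
  by apply: cvgM; [exact: left_continuity hf _ _ | exact: left_continuity hg _ _].
have -> : (fun h => h^-1 * (f (t + h) * g (t + h) - f t * g t)) =
    (fun h => h^-1 * (f (t + h) - f t) * g (t + h)
      + f t * (h^-1 * (g (t + h) - g t))).
  by apply/funext => h; ring.
apply: cvgD; apply: cvgM.
- exact: right_derivative hf _ _.
- exact: right_continuity hg _ _.
- exact: cvg_cst.
- exact: right_derivative hg _ _.
Qed.

Lemma has_right_derivativeZ (c : R) g d : has_right_derivative g d ->
  has_right_derivative (fun t => c * g t) (fun t => c * d t).
Proof.
move=> hg; have := has_right_derivativeM (has_right_derivative_cst c) hg.
by under [X in has_right_derivative _ X]eq_fun do rewrite mul0r add0r.
Qed.

Lemma has_right_derivative_affine (e : R) :
  has_right_derivative (fun t => e * (1 + t)) (fun=> e).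
Proof.
rewrite [X in has_right_derivative _ X](_ : _ = fun=> e * (0 + 1)); last first.
  by apply/funext => t; rewrite add0r mulr1.
apply: has_right_derivativeZ; apply: has_right_derivativeD.
  exact: has_right_derivative_cst.
exact: has_right_derivative_id.
Qed.

Lemma has_right_derivativeB f g d e :
  has_right_derivative f d -> has_right_derivative g e ->
  has_right_derivative (fun t => f t - g t) (fun t => d t - e t).
Proof.
move=> hf /(has_right_derivativeZ (-1)) hg.
have := has_right_derivativeD hf hg.
under eq_fun do rewrite mulN1r.
by under [X in has_right_derivative _ X]eq_fun do rewrite mulN1r.
Qed.

Lemma is_derive_left_continuity g (t l : R) : is_derive t 1 g l ->
  g (t - h) @[h --> 0^'+] --> g t.
Proof.
move=> [/derivable1_diffP/differentiable_continuous cg _].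
have ct : t - h @[h --> 0^'+] --> t.
  have /[!subr0] : t - h @[h --> 0^'+] --> t - 0 by
    apply: cvgB; [exact: cvg_cst | exact: cvg_id_at_right0].
  exact.
exact: cvg_comp ct cg.
Qed.

Lemma is_derive_right_derivative g (t l : R) : is_derive t 1 g l ->
  h^-1 * (g (t + h) - g t) @[h --> 0^'+] --> l.
Proof.
move=> [dg <-]; apply: cvg_dnbhs_at_right.
rewrite /derive /=.
under eq_fun => h do rewrite -[h in t + h]mulr1 (addrC t).
exact: dg.
Qed.

Lemma has_right_derivative_exp (k : R) :
  has_right_derivative (fun t => expR (k * t)) (fun t => k * expR (k * t)).
Proof.
have D (t : R) : is_derive t 1 (fun s : R => expR (k * s)) (k * expR (k * t)).
  rewrite mulrC.
  have Dk : is_derive t 1 (fun s : R => k * s) k.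
    by rewrite -[X in is_derive _ _ _ X]mulr1; exact: is_deriveZ.
  exact: is_derive1_comp.
split=> t _; [exact: is_derive_left_continuity | exact: is_derive_right_derivative].
Qed.

Lemma right_derivative_lt0 g (t l : R) : g t <= 0 -> l < 0 ->
  h^-1 * (g (t + h) - g t) @[h --> 0^'+] --> l ->
  \forall h \near 0^'+, g (t + h) <= 0.
Proof.
move=> gt l0 /cvgr_lt /(_ _ l0) H; near=> h.
have h0 : 0 < h by near: h; exact: nbhs_right_gt.
have : h^-1 * (g (t + h) - g t) < 0 by near: h; exact: H.
rewrite pmulr_rlt0 ?invr_gt0 //; lra.
Unshelve. all: by end_near. Qed.

(* First crossing: the set of times up to which all [g k] stay nonpositive is
   closed by left continuity and open to the right by the sign condition. *)
Lemma barrier (I : finType) (Q : pred I) (g d : I -> R -> R) :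
  (forall k, Q k -> has_right_derivative (g k) (d k)) ->
  (forall k, Q k -> g k 0 <= 0) ->
  (forall k t, 0 <= t -> Q k -> (forall j, Q j -> g j t <= 0) -> g k t = 0 ->
    d k t < 0) ->
  forall k t, 0 <= t -> Q k -> g k t <= 0.
Proof.
move=> hg g0 hd k T T0 Qk.
pose good t := forall s, 0 <= s <= t -> forall k, Q k -> g k s <= 0.
suff : good T by apply => //; rewrite T0 lexx.
apply: contrapT => badT.
pose S := [set t | 0 <= t /\ good t].
have S0 : S 0.
  split=> // s s0 j Qj; have -> : s = 0 by lra.
  exact: g0.
have ubT : ubound S T.
  move=> t [t0 gt]; rewrite leNgt; apply/negP => Tt; apply: badT => s sT.
  by apply: gt; lra.
have hS : has_sup S by split; [exists 0 | exists T].
pose m := sup S.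
have m0 : 0 <= m by exact: ub_le_sup hS.2 _ S0.
have lt_good s : 0 <= s < m -> forall j, Q j -> g j s <= 0.
  move=> /andP[s0 sm] j Qj.
  have ms : 0 < m - s by lra.
  have [t [t0 gt] mt] := sup_adherent ms hS.
  apply: gt => //; move: mt; rewrite -/m; lra.
have m_good j : Q j -> g j m <= 0.
  move=> Qj; have [m00|mn0] := eqVneq m 0; first by rewrite m00; exact: g0.
  have mp : 0 < m by lra.
  rewrite leNgt; apply/negP => gm.
  have /cvgr_gt /(_ _ gm) H := left_continuity (hg j Qj) mp.
  have : \forall h \near (0:R)^'+, False.
    near=> h.
    have h0 : 0 < h by near: h; exact: nbhs_right_gt.
    have hm : h < m by near: h; exact: nbhs_right_lt.
    have : 0 < g j (m - h) by near: h; exact: H.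
    by apply/negP; rewrite -leNgt; apply: lt_good => //; lra.
  by move=> /filter_ex [].
(* At [m] the sign extends to the right in either case: a zero value is pushed down by the negative
   derivative, and a negative value persists by right continuity. *)
have near_good j : Q j -> \forall h \near (0:R)^'+, g j (m + h) <= 0.
  move=> Qj; have := m_good j Qj; rewrite le_eqVlt => /orP[/eqP gm|gm].
    apply: (@right_derivative_lt0 _ _ (d j m)); first by rewrite gm.
      exact: hd.
    exact: right_derivative (hg j Qj) _ m0.
  have /cvgr_lt /(_ _ gm) := right_continuity (hg j Qj) m0.
  by apply: filterS => h /ltW.
(* Finiteness of [I] gives one neighbourhood for all indices, hence a good time beyond the supremum
   [m]. *)
have all_good : \forall h \near (0:R)^'+, forall j, Q j -> g j (m + h) <= 0.
  rewrite near_withinE /=.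
  have H j : \forall h \near (0:R), 0 < h -> Q j -> g j (m + h) <= 0.
    have [Qj|nQj] := boolP (Q j); last by near=> h.
    have := near_good j Qj; rewrite near_withinE /=.
    by apply: filterS => h + h0 _; exact.
  apply: filterS (filter_forall _ H) => h A h0 j; exact: A.
have [e e0 He] : exists2 e, 0 < e & forall h, 0 < h < e ->
    forall j, Q j -> g j (m + h) <= 0.
  move: all_good; rewrite near_withinE => -[e /= e0 He]; exists e => // h he.
  have /= A := He h; apply: A; last by lra.
  rewrite /ball_ /=; rewrite sub0r normrN gtr0_norm; lra.
have : S (m + e / 2).
  split; first by lra.
  move=> s sm j Qj.
  have [sm'|ms|->] := ltgtP s m.
  - by apply: lt_good => //; lra.
  - have -> : s = m + (s - m) by ring.
    by apply: He => //; lra.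
  - exact: m_good.
move=> /(ub_le_sup hS.2); rewrite -/m; lra.
Unshelve. all: by end_near. Qed.

End RightDerivative.

(** * Markov semigroups *)

Section Semigroup.
Context (R : realType) (S : finType) (r : S -> S -> R) (K : R -> S -> S -> R).
Context (semiK : is_transition_semigroup r K).
Implicit Types (f g : S -> R) (x y : S).

(** Serves both the Markov kernels [K t] and the generator, whose entries may be negative. *)
Definition kernel_apply (k : S -> S -> R) f x : R := \sum_y k x y * f y.

Notation Pt t := (kernel_apply (K t)).
Notation L := (kernel_apply (generator r)).

Lemma kernel_applyB (k : S -> S -> R) f g x :
  kernel_apply k (fun y => f y - g y) x = kernel_apply k f x - kernel_apply k g x.
Proof.
by rewrite /kernel_apply -sumrB; apply: eq_bigr => y _; rewrite mulrBr.
Qed.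

Lemma semigroup_apply0 f x : Pt 0 f x = f x.
Proof.
rewrite /kernel_apply (bigD1 x) //= (semigroup_id semiK) eqxx mul1r.
rewrite big1 ?addr0 // => y yx.
by rewrite (semigroup_id semiK) eq_sym (negbTE yx) mul0r.
Qed.

Lemma semigroup_applyD (s t : R) f x : 0 <= s -> 0 <= t ->
  Pt (s + t) f x = Pt s (Pt t f) x.
Proof.
move=> s0 t0; rewrite /kernel_apply.
under eq_bigr do rewrite (semigroup_comp semiK _ _ s0 t0) mulr_suml.
rewrite exchange_big /=; apply: eq_bigr => z _.
by rewrite mulr_sumr; apply: eq_bigr => y _; rewrite mulrA.
Qed.

Lemma semigroup_apply_le (t : R) f g x : 0 <= t -> (forall y, f y <= g y) ->
  Pt t f x <= Pt t g x.
Proof.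
move=> t0 fg; apply: ler_sum => y _.
by rewrite ler_wpM2l // (semigroup_ge0 semiK).
Qed.

Lemma semigroup_apply_cst (t c : R) x : 0 <= t -> Pt t (fun=> c) x = c.
Proof.
by move=> t0; rewrite /kernel_apply -mulr_suml (semigroup_sum1 semiK) ?mul1r.
Qed.

Lemma semigroup_apply_norm (t : R) f x : 0 <= t ->
  `|Pt t f x| <= \sum_y `|f y|.
Proof.
move=> t0; apply: (le_trans (ler_norm_sum _ _ _)); apply: ler_sum => y _.
rewrite normrM ger0_norm ?(semigroup_ge0 semiK) // ler_piMl //.
rewrite -(semigroup_sum1 semiK x t0) (bigD1 y) //= lerDl.
by apply: sumr_ge0 => z _; rewrite (semigroup_ge0 semiK).
Qed.

Lemma semigroup_apply_right_derivative0 f x :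
  h^-1 * (Pt h f x - f x) @[h --> 0^'+] --> L f x.
Proof.
have -> : (fun h => h^-1 * (Pt h f x - f x)) =
    (fun h => \sum_y h^-1 * (K h x y - K 0 x y) * f y).
  apply/funext => h; rewrite -[in LHS](semigroup_apply0 f x) -sumrB mulr_sumr.
  by apply: eq_bigr => y _; ring.
apply: cvg_big => [|y _]; first exact: add_continuous.
apply: cvgM; last exact: cvg_cst.
exact: semigroup_gen semiK x y.
Qed.

Lemma semigroup_apply_near0 f x : Pt h f x - f x @[h --> 0^'+] --> (0 : R).
Proof.
rewrite (_ : nbhs (0 : R) = nbhs (0 * L f x)); last by rewrite mul0r.
apply: (@cvg_trans _
  ((h * (h^-1 * (Pt h f x - f x))) @[h --> 0^'+])).
  apply: near_eq_cvg; near=> h.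
  have h0 : h != 0 by near: h; exact: nbhs_right_neq.
  by rewrite mulrA divff // mul1r.
apply: cvgM; first exact: cvg_id_at_right0.
exact: semigroup_apply_right_derivative0.
Unshelve. all: by end_near. Qed.

(** Since [Pt t f = Pt (t - h) (Pt h f)] and [Pt (t - h)] is bounded uniformly in [h], the claim
    reduces to convergence of [Pt h f] to [f] as [h] tends to [0]. *)
Lemma semigroup_apply_left_continuity f x (t : R) : 0 < t ->
  Pt (t - h) f x @[h --> 0^'+] --> Pt t f x.
Proof.
move=> t0; pose e h := \sum_y `|Pt h f y - f y|.
have e0 : e h @[h --> 0^'+] --> (0 : R).
  rewrite (_ : nbhs (0 : R) = nbhs (\sum_(y : S) (0 : R))); last by rewrite big1.
  apply: cvg_big => [|y _]; first exact: add_continuous.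
  apply/norm_cvg0P; exact: semigroup_apply_near0.
apply/cvgrPdist_le => eps eps0; near=> h.
have h0 : 0 < h by near: h; exact: nbhs_right_gt.
have ht : h < t by near: h; exact: nbhs_right_lt.
have th0 : 0 <= t - h by lra.
have -> : Pt t f x = Pt (t - h) (Pt h f) x.
  by rewrite -(semigroup_applyD f x th0 (ltW h0)) subrK.
rewrite -kernel_applyB; apply: (le_trans (semigroup_apply_norm _ _ th0)).
rewrite -/(e h); near: h; exact: cvgr_le e0 _ eps0.
Unshelve. all: by end_near. Qed.

(** Splitting off a short first step puts the generator outside the semigroup. This form suits the
    arguments at an extremal state. *)
Lemma has_right_derivative_backward f x :
  has_right_derivative (fun t => Pt t f x) (fun t => L (Pt t f) x).
Proof.
split=> t t0; first exact: semigroup_apply_left_continuity.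
apply: (@cvg_trans _ ((h^-1 * (Pt h (Pt t f) x - Pt t f x)) @[h --> 0^'+])).
  apply: near_eq_cvg; near=> h.
  have h0 : 0 < h by near: h; exact: nbhs_right_gt.
  by rewrite (addrC t) (semigroup_applyD f x (ltW h0) t0).
exact: semigroup_apply_right_derivative0.
Unshelve. all: by end_near. Qed.

(** Splitting off a short last step puts the generator next to [f]. This form gives the equation for
    the mean. *)
Lemma has_right_derivative_forward f x :
  has_right_derivative (fun t => Pt t f x) (fun t => Pt t (L f) x).
Proof.
split=> t t0; first exact: semigroup_apply_left_continuity.
apply: (@cvg_trans _
    ((\sum_y K t x y * (h^-1 * (Pt h f y - f y))) @[h --> 0^'+])).
  apply: near_eq_cvg; near=> h.
  have h0 : 0 < h by near: h; exact: nbhs_right_gt.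
  rewrite (semigroup_applyD f x t0 (ltW h0)) -kernel_applyB mulr_sumr.
  by apply: eq_bigr => y _; ring.
apply: cvg_big => [|y _]; first exact: add_continuous.
apply: cvgM; first exact: cvg_cst.
exact: semigroup_apply_right_derivative0.
Unshelve. all: by end_near. Qed.

Lemma generator_applyE f x : L f x = \sum_(y | y != x) r x y * (f y - f x).
Proof.
rewrite /kernel_apply (bigD1 x) //= /generator eqxx mulNr mulr_suml addrC.
rewrite -sumrB; apply: eq_bigr => y yx.
by rewrite eq_sym (negbTE yx) mulrBr.
Qed.

End Semigroup.

(** * Generator of a spin system *)

Section SpinGenerator.
Context (R : realType) (n : nat) (lambda mu : 'I_n -> config n -> R).

Definition flip_rate (i : 'I_n) (x : config n) : R :=
  if x i then mu i x else lambda i x.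

Lemma spin_generatorE (f : config n -> R) x :
  kernel_apply (generator (spin_rate lambda mu)) f x =
  \sum_i flip_rate i x * (f (flip x i) - f x).
Proof.
rewrite generator_applyE /spin_rate.
under eq_bigr do rewrite mulr_suml.
rewrite (exchange_big_dep predT) //=; apply: eq_bigr => i _.
have nx : flip x i != x.
  apply/eqP => /ffunP/(_ i); rewrite ffunE eqxx; by case: (x i).
rewrite (bigD1 (flip x i)) ?nx ?eqxx //= big1 ?addr0 // => y.
by move=> /andP[/andP[_ /eqP->]]; rewrite eqxx.
Qed.

End SpinGenerator.

(** * Attractive spin systems *)

Definition config_le (n : nat) (x y : config n) : bool :=
  [forall i, x i ==> y i].

Definition config_increasing (R : realType) (n : nat) (f : config n -> R) :=
  forall x y, config_le x y -> f x <= f y.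

Lemma config_leP (n : nat) (x y : config n) :
  reflect (forall i, x i -> y i) (config_le x y).
Proof.
by apply: (iffP forallP) => H i; apply/implyP; exact: H.
Qed.

Lemma flipE (n : nat) (x : config n) (i j : 'I_n) :
  flip x i j = if j == i then ~~ x j else x j.
Proof. by rewrite ffunE. Qed.

(** Removes the slack [e * (1 + t)] that is carried along to obtain the strict sign in [barrier]. *)
Lemma le_forall_pos_scale (R : realType) (a t : R) : 0 <= t ->
  (forall e, 0 < e -> a - e * (1 + t) <= 0) -> a <= 0.
Proof.
move=> t0 H; rewrite leNgt; apply/negP => a0.
have t1 : 0 < 2 * (1 + t) by lra.
have := H (a / (2 * (1 + t))) (divr_gt0 a0 t1).
have -> : a / (2 * (1 + t)) * (1 + t) = a / 2 by field; lra.
by lra.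
Qed.

Section Attractive.
Context (R : realType) (n : nat) (lambda mu : 'I_n -> config n -> R).
Context (lambda_ge0 : forall i x, 0 <= lambda i x).
Context (mu_ge0 : forall i x, 0 <= mu i x).
Context (lambda_incr : forall i, config_increasing (lambda i)).
Context (mu_decr : forall i, config_increasing (fun x => - mu i x)).
Context (K : R -> config n -> config n -> R).
Context (semiK : is_transition_semigroup (spin_rate lambda mu) K).

Notation Pt t := (kernel_apply (K t)).
Notation L := (kernel_apply (generator (spin_rate lambda mu))).

Lemma flip_rate_ge0 i x : 0 <= flip_rate lambda mu i x.
Proof. by rewrite /flip_rate; case: ifP. Qed.

(* Minimum principle for the monotone coupling: at a worst ordered pair every
   coupled jump leads to another ordered pair. *)
Lemma spin_generator_coupling (u : config n -> R) x y : config_le x y ->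
  (forall x' y', config_le x' y' -> u x' - u y' <= u x - u y) ->
  L u x <= L u y.
Proof.
move=> xy H; rewrite !spin_generatorE; apply: ler_sum => i _; rewrite /flip_rate.
have le_fx_y : x i || y i -> config_le (flip x i) y.
  move=> xyi; apply/config_leP => j; rewrite flipE.
  case: eqP => [->|_]; last exact: (config_leP _ _ xy).
  by move=> nxi; move: xyi; rewrite (negbTE nxi).
have le_x_fy : ~~ x i || ~~ y i -> config_le x (flip y i).
  move=> xyi; apply/config_leP => j; rewrite flipE.
  case: eqP => [->|_]; last exact: (config_leP _ _ xy).
  by move=> xi; move: xyi; rewrite xi.
have le_fx_fy : x i = y i -> config_le (flip x i) (flip y i).
  move=> xyi; apply/config_leP => j; rewrite !flipE.
  case: eqP => [->|_]; last exact: (config_leP _ _ xy).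
  by rewrite xyi.
have lxy := lambda_incr i xy; have mxy := mu_decr i xy.
have := config_leP _ _ xy i.
(* Where [x] and [y] agree at [i] they flip together at the smaller of their two rates, [mu i y] or
   [lambda i x], and the excess rate moves one of them alone. Where they differ, each flips
   alone. *)
case xi : (x i); case yi : (y i) => [] //.
- move=> _; have A := H _ _ (le_fx_fy (etrans xi (esym yi))).
  have B : u (flip x i) - u y <= u x - u y by apply/H/le_fx_y; rewrite xi.
  apply: (@le_trans _ _ (mu i y * (u (flip x i) - u x))).
    by apply: ler_wnM2r; lra.
  by apply: ler_wpM2l => //; lra.
- by move=> /(_ isT).
- have B : u (flip x i) - u y <= u x - u y.
    by apply/H/le_fx_y; rewrite yi orbT.
  have C : u x - u (flip y i) <= u x - u y by apply/H/le_x_fy; rewrite xi.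
  move=> _; apply: (@le_trans _ _ 0).
    by apply: mulr_ge0_le0 => //; lra.
  by apply: mulr_ge0 => //; lra.
- move=> _; have A := H _ _ (le_fx_fy (etrans xi (esym yi))).
  have C : u x - u (flip y i) <= u x - u y by apply/H/le_x_fy; rewrite xi.
  apply: (@le_trans _ _ (lambda i x * (u (flip y i) - u y))).
    by apply: ler_wpM2l => //; lra.
  by apply: ler_wpM2r; lra.
Qed.

Lemma attractive_increasing (t : R) f : 0 <= t -> config_increasing f ->
  config_increasing (Pt t f).
Proof.
move=> t0 fincr x y xy; rewrite -subr_le0.
apply: (le_forall_pos_scale t0) => e e0.
pose g (z : config n * config n) s := Pt s f z.1 - Pt s f z.2 - e * (1 + s).
pose d (z : config n * config n) s :=
  L (Pt s f) z.1 - L (Pt s f) z.2 - e.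
apply: (@barrier R _ (fun z => config_le z.1 z.2) g d _ _ _ (x, y) t) => //=.
- move=> z _; apply: has_right_derivativeB.
    by apply: has_right_derivativeB; exact: has_right_derivative_backward semiK _ _.
  exact: has_right_derivative_affine.
- move=> z /fincr; rewrite /g !(semigroup_apply0 semiK); lra.
(* Since [g z] is zero and every other ordered pair has a nonpositive value, [z] maximizes the
   difference, which is what the coupling lemma asks for. *)
- move=> z s s0 zle H gz.
  suff : L (Pt s f) z.1 <= L (Pt s f) z.2 by rewrite /d; lra.
  apply: spin_generator_coupling => // x' y' le'.
  have := H (x', y') le'; move: gz; rewrite /g /=; lra.
Qed.

(* Harris' inequality: only one coordinate moves at a time, so the carre du
   champ [L(FG) - F LG - G LF] of two increasing functions is nonnegative. *)
Lemma attractive_harris (t : R) f g x : 0 <= t ->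
  config_increasing f -> config_increasing g ->
  Pt t f x * Pt t g x <= Pt t (fun y => f y * g y) x.
Proof.
move=> t0 fincr gincr; rewrite -subr_le0.
apply: (le_forall_pos_scale t0) => e e0.
pose fg y := f y * g y.
pose h z s := Pt s f z * Pt s g z - Pt s fg z - e * (1 + s).
pose d z s := L (Pt s f) z * Pt s g z + Pt s f z * L (Pt s g) z
  - L (Pt s fg) z - e.
apply: (@barrier R _ predT h d _ _ _ x t) => //.
- move=> z _; apply: has_right_derivativeB; last exact: has_right_derivative_affine.
  apply: has_right_derivativeB; last exact: has_right_derivative_backward semiK _ _.
  by apply: has_right_derivativeM; exact: has_right_derivative_backward semiK _ _.
- move=> z _; rewrite /h !(semigroup_apply0 semiK) /fg; lra.
- move=> z s s0 _ H hz.
  suff : L (Pt s f) z * Pt s g z + Pt s f z * L (Pt s g) z - L (Pt s fg) z <= 0.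
    by rewrite /d; lra.
  rewrite !spin_generatorE mulr_suml mulr_sumr -big_split /= -sumrB.
  apply: sumr_le0 => i _.
  have c0 := flip_rate_ge0 i z.
  have := H (flip z i) isT; move: hz; rewrite /h.
  (* [z] and [flip z i] are comparable, so the increments of the two increasing functions do not
     have opposite signs. *)
  have : 0 <= (Pt s f (flip z i) - Pt s f z) * (Pt s g (flip z i) - Pt s g z).
    have [zi|zi] := boolP (z i).
      have le : config_le (flip z i) z.
        apply/config_leP => j; rewrite flipE.
        by case: eqP => [->|]; rewrite ?zi.
      have := attractive_increasing s0 fincr le.
      have := attractive_increasing s0 gincr le.
      by move=> A B; apply: mulr_le0; lra.
    have le : config_le z (flip z i).
      apply/config_leP => j; rewrite flipE.
      by case: eqP => [->|]; rewrite ?(negbTE zi).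
    have := attractive_increasing s0 fincr le.
    have := attractive_increasing s0 gincr le.
    by move=> A B; apply: mulr_ge0; lra.
  move: c0; set c := flip_rate _ _ _ _.
  set F := Pt s f z; set G := Pt s g z; set H0 := Pt s fg z.
  set F' := Pt s f (flip z i); set G' := Pt s g (flip z i).
  set H' := Pt s fg (flip z i) => c0 D A B.
  (* As (F' - F)G + F(G' - G) = F'G' - FG - (F' - F)(G' - G), the bracket is at most the increment
     of FG - H0 along the flip, which is nonpositive because [z] is a worst state. *)
  rewrite (_ : _ - _ = c * ((F' - F) * G + F * (G' - G) - (H' - H0))); last by ring.
  apply: mulr_ge0_le0 => //; lra.
Qed.

End Attractive.

(** * Convexity on the cube *)

Section CubeConvexity.
Context (R : realType) (n : nat).
Implicit Types (f : 'rV[R]_n -> R) (x y : 'rV[R]_n).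

Lemma convex_on_cube_le f (a : R) x y : convex_on_cube f -> 0 <= a <= 1 ->
  unit_cube x -> unit_cube y ->
  f (a *: x + (1 - a) *: y) <= a * f x + (1 - a) * f y.
Proof.
move=> cf /andP[a0 a1] cx cy.
have := cf (Itv01 a0 a1) x y; rewrite !inE => /(_ cx cy).
by rewrite convRE.
Qed.

Lemma unit_cube_convex (a : R) x y : 0 <= a <= 1 ->
  unit_cube x -> unit_cube y -> unit_cube (a *: x + (1 - a) *: y).
Proof.
by move=> a01 cx cy j; rewrite !mxE; have := cx j; have := cy j; nra.
Qed.

Lemma unit_cube0 : unit_cube (0 : 'rV[R]_n).
Proof. by move=> j; rewrite mxE lexx ler01. Qed.

Lemma unit_cube_vertex (x : config n) : unit_cube (vertex R x).
Proof. by move=> j; rewrite mxE; case: (x j); rewrite ?lexx ?ler01. Qed.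

(* The slack mass sits at a base point [z], so that no normalization of the
   weights is needed in the induction. *)
Lemma jensen_seq f (S : Type) (r : seq S) (w : S -> R) (v : S -> 'rV[R]_n) z :
  convex_on_cube f -> (forall s, 0 <= w s) -> (forall s, unit_cube (v s)) ->
  \sum_(s <- r) w s <= 1 -> unit_cube z ->
  f (\sum_(s <- r) w s *: v s + (1 - \sum_(s <- r) w s) *: z) <=
    \sum_(s <- r) w s * f (v s) + (1 - \sum_(s <- r) w s) * f z.
Proof.
move=> cf w0 cv; elim: r z => [|s r IH] z.
  by rewrite !big_nil subr0 !add0r !scale1r mul1r.
rewrite !big_cons; set W := \sum_(j <- r) w j => sW cz.
have W0 : 0 <= W by exact: sumr_ge0.
have ws := w0 s.
have [W1|W1] := eqVneq W 1.
  have -> : w s = 0 by lra.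
  by rewrite scale0r mul0r !add0r; apply: IH => //; rewrite -/W W1.
have W1' : 0 < 1 - W by lra.
(* [a] is the share of [v s] in the slack [1 - W] of the tail: the induction hypothesis is applied
   with [v s] absorbed into the base point. *)
pose a := w s / (1 - W).
have a01 : 0 <= a <= 1.
  by rewrite divr_ge0 ?(ltW W1') //= ler_pdivrMr //; lra.
have aW : (1 - W) * a = w s by rewrite /a mulrC divfK // gt_eqF.
have aW' : (1 - W) * (1 - a) = 1 - (w s + W) by rewrite mulrBr aW; ring.
have := IH (a *: v s + (1 - a) *: z) _ (unit_cube_convex a01 (cv s) cz).
rewrite scalerDr !scalerA aW aW' -/W => /(_ ltac:(lra)) H.
rewrite -addrA addrCA; apply: (le_trans H).
rewrite -addrA addrCA lerD2l.
rewrite -aW' -aW -!(mulrA (1 - W)) -mulrDr ler_pM2l //.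
exact: convex_on_cube_le.
Qed.

Lemma jensen f (S : finType) (w : S -> R) (v : S -> 'rV[R]_n) :
  convex_on_cube f -> (forall s, 0 <= w s) -> (forall s, unit_cube (v s)) ->
  \sum_s w s = 1 ->
  f (\sum_s w s *: v s) <= \sum_s w s * f (v s).
Proof.
move=> cf w0 cv w1.
have w1' : \sum_s w s <= 1 by rewrite w1.
have := jensen_seq cf w0 cv w1' (@unit_cube0).
by rewrite w1 subrr scale0r mul0r !addr0; exact.
Qed.

(* Concavity along the ray from the origin, where [f] is nonnegative. *)
Lemma concave_scale f (c : R) x y : concave_on_cube f ->
  increasing_on_cube f -> (forall z, unit_cube z -> 0 <= f z) -> 1 <= c ->
  unit_cube x -> unit_cube y -> (forall j, y ord0 j <= c * x ord0 j) ->
  f y <= c * f x.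
Proof.
move=> cf incf f0 c1 cx cy yx.
have c0 : 0 < c by lra.
have ci : 0 <= c^-1 <= 1 by rewrite invr_ge0 ltW //= invf_le1.
have := convex_on_cube_le cf ci cy (@unit_cube0).
rewrite scaler0 addr0 => H.
have cyc : unit_cube (c^-1 *: y).
  move=> j; rewrite mxE; have := cy j; nra.
have : f (c^-1 *: y) <= f x.
  apply: incf => // j; rewrite mxE ler_pdivrMl //.
have f00 : 0 <= (1 - c^-1) * f 0.
  apply: mulr_ge0; last exact/f0/unit_cube0.
  by case/andP: ci; lra.
move=> H'; rewrite -ler_pdivrMl //; lra.
Qed.

End CubeConvexity.

(** * Monotonicity and subhomogeneity of the drift *)

Section MeanFieldDrift.
Context (R : realType) (n : nat) (lambda mu : 'I_n -> 'rV[R]_n -> R).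
Context (lambda_ge0 : forall i x, unit_cube x -> 0 <= lambda i x).
Context (mu_ge0 : forall i x, unit_cube x -> 0 <= mu i x).
Context (lambda_incr : forall i, increasing_on_cube (lambda i)).
Context (lambda_concave : forall i, concave_on_cube (lambda i)).
Context (mu_decr : forall i, decreasing_on_cube (mu i)).
Context (mu_convex : forall i, convex_on_cube (mu i)).
Context (sum_incr : forall i, increasing_on_cube (fun x => lambda i x + mu i x)).
Implicit Types (x y p q : 'rV[R]_n).

Notation drift := (mean_field_drift lambda mu).

(** With coordinate [i] fixed, raising the others increases [lambda i] and decreases [mu i], whose
    coefficients in the drift are nonnegative and nonpositive. *)
Lemma mean_field_drift_cooperative i x y : unit_cube x -> unit_cube y ->
  (forall j, x ord0 j <= y ord0 j) -> x ord0 i = y ord0 i ->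
  drift i x <= drift i y.
Proof.
move=> cx cy xy xyi; rewrite /mean_field_drift xyi.
have := lambda_incr i cx cy xy; have := mu_decr i cx cy xy.
have := cy i; nra.
Qed.

(* Joining [q] with [p] first makes the total rate [lambda + mu], which only
   increases, comparable at the two points. *)
Lemma mean_field_drift_scale i (c : R) p q : unit_cube p -> unit_cube q ->
  1 <= c -> (forall j, q ord0 j <= c * p ord0 j) ->
  q ord0 i = c * p ord0 i -> drift i q <= c * drift i p.
Proof.
move=> cp cq c1 qp qi.
pose r : 'rV[R]_n := \row_j Num.max (p ord0 j) (q ord0 j).
have cr : unit_cube r.
  move=> j; have /andP[p0 p1] := cp j; have /andP[q0 q1] := cq j.
  by rewrite mxE le_max ge_max p0 p1 q1.
have ri : q ord0 i = r ord0 i.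
  by rewrite mxE max_r // qi; have := cp i; nra.
have qr : drift i q <= drift i r.
  apply: mean_field_drift_cooperative => // j.
  by rewrite mxE le_max lexx orbT.
apply: (le_trans qr); rewrite /mean_field_drift -ri qi.
have pr j : p ord0 j <= r ord0 j by rewrite mxE le_max lexx.
have rp j : r ord0 j <= c * p ord0 j.
  rewrite mxE ge_max qp andbT; have := cp j; nra.
(* In the form [lambda - x_i (lambda + mu)] of the drift, from [p] to [r] the first term grows at
   most by the factor [c], and the subtracted total rate does not decrease. *)
have H1 := concave_scale (lambda_concave i) (@lambda_incr i) (@lambda_ge0 i)
  c1 cp cr rp.
have H2 := sum_incr i cp cr pr; rewrite /= in H2.
have pi0 : 0 <= c * p ord0 i by have := cp i; nra.
have H3 : 0 <= c * p ord0 i * (lambda i r + mu i r - (lambda i p + mu i p)).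
  by apply: mulr_ge0 => //; lra.
lra.
Qed.

End MeanFieldDrift.

(** * Mean-field equation and mean of the spin system *)

Section MeanField.
Context (R : realType) (n : nat) (lambda mu : 'I_n -> 'rV[R]_n -> R).
Context (lambda_ge0 : forall i x, unit_cube x -> 0 <= lambda i x).
Context (mu_ge0 : forall i x, unit_cube x -> 0 <= mu i x).
Context (lambda_incr : forall i, increasing_on_cube (lambda i)).
Context (lambda_concave : forall i, concave_on_cube (lambda i)).
Context (mu_decr : forall i, decreasing_on_cube (mu i)).
Context (p : R -> 'rV[R]_n) (solp : is_mean_field_solution lambda mu p).

Notation drift := (mean_field_drift lambda mu).

(** The shift by [s] lets the solution be restarted at a later time. When [s + t = 0] the one-sided
    equation at [0] applies. *)
Lemma mean_field_right_derivative (s : R) i : 0 <= s ->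
  has_right_derivative (fun t => p (s + t) ord0 i)
    (fun t => drift i (p (s + t))).
Proof.
move=> s0; split=> t t0.
  under eq_fun do rewrite addrA.
  apply: (@is_derive_left_continuity R (fun u => p u ord0 i)).
  by apply: mf_ode solp _ _ _; lra.
under eq_fun do rewrite addrA.
have [st0|st0] := eqVneq (s + t) 0.
  rewrite st0; under eq_fun do rewrite add0r; exact: mf_ode0 solp i.
apply: (@is_derive_right_derivative R (fun u => p u ord0 i)).
by apply: mf_ode solp _ _ _; lra.
Qed.

(** As [mu i] is at most [mu i 0] on the cube, p_i' >= - mu_i(0) p_i, so decay is at most
    exponential. *)
Lemma mean_field_gt0 (s t : R) i : 0 <= s -> s <= t ->
  0 < p s ord0 i -> 0 < p t ord0 i.
Proof.
(* The additional [1] makes the derivative strictly negative at a zero of [g]. *)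
move=> s0 st ps; pose k := - (mu i 0 + 1).
pose g (_ : unit) u := p s ord0 i * expR (k * u) - p (s + u) ord0 i.
pose d (_ : unit) u :=
  p s ord0 i * (k * expR (k * u)) - drift i (p (s + u)).
have ts : 0 <= t - s by lra.
have := @barrier R unit predT g d _ _ _ tt (t - s) ts isT.
have -> : g tt (t - s) = p s ord0 i * expR (k * (t - s)) - p t ord0 i.
  by rewrite /g (addrC s) subrK.
have e0 := mulr_gt0 ps (expR_gt0 (k * (t - s))).
move=> H; suff : p s ord0 i * expR (k * (t - s)) - p t ord0 i <= 0 by lra.
apply: H.
- case=> _; apply: has_right_derivativeB.
    by apply: has_right_derivativeZ; exact: has_right_derivative_exp.
  exact: mean_field_right_derivative.
- by case=> _; rewrite /g mulr0 expR0 mulr1 addr0 subrr.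
- move=> [] u u0 _ _; rewrite /g /d /mean_field_drift.
  have := expR_gt0 (k * u); move: (expR (k * u)) => E E0 gu.
  have su : 0 <= s + u by lra.
  have cp := mf_cube solp su.
  have l0 := lambda_ge0 i cp.
  have m0 : mu i (p (s + u)) <= mu i 0.
    apply: mu_decr => // [|j]; first exact: unit_cube0.
    by rewrite mxE; case/andP: (cp j).
  rewrite mulrCA; have -> : p s ord0 i * E = p (s + u) ord0 i by lra.
  have pE : 0 < p (s + u) ord0 i by have := mulr_gt0 ps E0; lra.
  have /andP[_ p1] := cp i.
  have A : 0 <= p (s + u) ord0 i * (mu i 0 - mu i (p (s + u))).
    by apply: mulr_ge0; lra.
  have B : 0 <= (1 - p (s + u) ord0 i) * lambda i (p (s + u)).
    by apply: mulr_ge0; lra.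
  rewrite /k; lra.
Qed.

(** By [mean_field_gt0], a coordinate outside this set vanishes on a whole initial interval of
    positive length. *)
Definition mean_field_support : pred 'I_n :=
  [pred i | `[< forall t, 0 < t -> 0 < p t ord0 i >]].

Lemma mean_field_supportP i t : mean_field_support i -> 0 < t ->
  0 < p t ord0 i.
Proof. by move=> /asboolP; apply. Qed.

Definition support_vertex : config n := [ffun j => mean_field_support j].

(** While p_i stays at zero its drift is [lambda i (p s)], which must vanish. Since [p s] dominates
    a positive multiple of the support vertex, monotonicity and concavity carry this zero to the
    vertex. *)
Lemma lambda_support_vertex i : ~~ mean_field_support i ->
  lambda i (vertex R support_vertex) = 0.
Proof.
move=> /asboolPn /existsNP [t /not_implyP [t0 /negP pt]].
have ct := mf_cube solp (ltW t0).
(* A time inside the interval where p_i vanishes, so that the right difference quotients at [s] are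
   eventually zero. *)
pose s := t / 2.
have s0 : 0 < s by rewrite /s; lra.
have p0 u : 0 <= u <= t -> p u ord0 i = 0.
  move=> /andP[u0 ut]; have /andP[pu0 _] := mf_cube solp u0 i.
  apply/eqP; rewrite eq_le pu0 andbT leNgt; apply/negP => pu.
  by move/negP: pt; apply; exact: mean_field_gt0 pu.
have cs := mf_cube solp (ltW s0).
have ls : lambda i (p s) = 0.
  have := right_derivative (mean_field_right_derivative i (ltW s0)) (lexx 0).
  rewrite !addr0 => D.
  have <- : drift i (p s) = lambda i (p s).
    by rewrite /mean_field_drift p0 ?subr0 ?mul0r ?mul1r ?subr0 // /s; lra.
  apply: (cvg_unique (@norm_hausdorff R R) D).
  apply: (@cvg_trans _ ((fun=> 0 : R) @ (0 : R)^'+)); last exact: cvg_cst.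
  apply: near_eq_cvg; near=> h.
  have h0 : 0 < h by near: h; exact: nbhs_right_gt.
  have hs : h < s by near: h; exact: nbhs_right_lt.
  by rewrite add0r !p0 ?subrr ?mulr0 // /s; move: hs; rewrite /s; lra.
(* With factors in [0,1], the product is a positive lower bound for each of them, and it is [1] for
   an empty support. *)
pose m := \prod_(j | mean_field_support j) p s ord0 j.
have m0 : 0 < m by apply: prodr_gt0 => j Bj; exact: mean_field_supportP Bj s0.
have mp j : mean_field_support j -> m <= p s ord0 j.
  move=> Bj; rewrite /m (bigD1 j) //= ler_piMr //.
    by case/andP: (cs j).
  by apply: prodr_ile1 => l _; exact: cs.
have m1 : m <= 1 by apply: prodr_ile1 => l _; exact: cs.
have cv := @unit_cube_vertex R n support_vertex.
apply/eqP; rewrite eq_le lambda_ge0 // andbT.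
have m01 : 0 <= m <= 1 by rewrite (ltW m0).
have c0 := @unit_cube0 R n.
have H := convex_on_cube_le (@lambda_concave i) m01 cv c0.
have cm := unit_cube_convex m01 cv c0.
have : lambda i (m *: vertex R support_vertex + (1 - m) *: 0) <= lambda i (p s).
  apply: lambda_incr => // j; rewrite !mxE ffunE mulr0 addr0.
  have [Bj|_] := boolP (mean_field_support j); first by rewrite mulr1 mp.
  by rewrite mulr0; case/andP: (cs j).
rewrite ls => H2.
have H3 : 0 <= (1 - m) * lambda i 0 by apply: mulr_ge0; [lra | exact: lambda_ge0].
by rewrite -(pmulr_rle0 _ m0); lra.
Unshelve. all: by end_near. Qed.

End MeanField.

(** * Mean of the spin system and its differential inequality *)

Section SpinMean.
Context (R : realType) (n : nat) (lambda0 mu0 : 'I_n -> config n -> R).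
Context (lambda mu : 'I_n -> 'rV[R]_n -> R).
Context (lambda_ext : forall i x, lambda i (vertex R x) = lambda0 i x).
Context (mu_ext : forall i x, mu i (vertex R x) = mu0 i x).
Context (lambda_ge0 : forall i x, unit_cube x -> 0 <= lambda i x).
Context (mu_ge0 : forall i x, unit_cube x -> 0 <= mu i x).
Context (lambda_incr : forall i, increasing_on_cube (lambda i)).
Context (lambda_concave : forall i, concave_on_cube (lambda i)).
Context (mu_decr : forall i, decreasing_on_cube (mu i)).
Context (mu_convex : forall i, convex_on_cube (mu i)).
Context (sum_incr : forall i, increasing_on_cube (fun x => lambda i x + mu i x)).
Context (K : R -> config n -> config n -> R).
Context (semiK : is_transition_semigroup (spin_rate lambda0 mu0) K).
Context (x0 : config n).

Notation Pt t := (kernel_apply (K t)).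
Notation L := (kernel_apply (generator (spin_rate lambda0 mu0))).
Notation drift := (mean_field_drift lambda mu).

Definition coordinate (i : 'I_n) (x : config n) : R := (x i)%:R.

Definition spin_mean (t : R) : 'rV[R]_n := \row_i Pt t (coordinate i) x0.

Lemma increasing_vertex (f : 'rV[R]_n -> R) : increasing_on_cube f ->
  config_increasing (fun x => f (vertex R x)).
Proof.
move=> incf x y /config_leP xy; apply: incf; try exact: unit_cube_vertex.
by move=> j; rewrite !mxE ler_nat; have := xy j; case: (x j); case: (y j) => // ->.
Qed.

Lemma coordinate_increasing i : config_increasing (coordinate i).
Proof.
move=> x y /config_leP /(_ i); rewrite /coordinate ler_nat.
by case: (x i); case: (y i) => // ->.
Qed.

Lemma generator_coordinate i x :
  L (coordinate i) x = lambda0 i x - coordinate i x * (lambda0 i x + mu0 i x).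
Proof.
rewrite spin_generatorE (bigD1 i) //= big1 ?addr0 => [|j ji].
  by rewrite /coordinate flipE eqxx /flip_rate; case: (x i) => /=; ring.
by rewrite /coordinate flipE eq_sym (negbTE ji) subrr mulr0.
Qed.

Lemma spin_mean_cube t : 0 <= t -> unit_cube (spin_mean t).
Proof.
move=> t0 j; rewrite mxE.
rewrite -{1}(semigroup_apply_cst semiK 0 x0 t0).
rewrite -[X in _ && (_ <= X)](semigroup_apply_cst semiK 1 x0 t0).
by apply/andP; split; apply: semigroup_apply_le semiK _ _ _ _ t0 _ => y;
  rewrite /coordinate; case: (y j); rewrite ?ler01 ?lexx.
Qed.

(** Exhibits the mean as a barycentre of cube vertices, the form to which Jensen's inequality
    applies. *)
Lemma spin_meanE t : spin_mean t = \sum_y K t x0 y *: vertex R y.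
Proof.
by apply/rowP => j; rewrite summxE !mxE; apply: eq_bigr => y _; rewrite !mxE.
Qed.

Lemma spin_mean_jensen f t : convex_on_cube f -> 0 <= t ->
  f (spin_mean t) <= Pt t (fun y => f (vertex R y)) x0.
Proof.
move=> cf t0; rewrite spin_meanE; apply: jensen => //.
- by move=> y; exact: semigroup_ge0 semiK _ _ _ t0.
- exact: unit_cube_vertex.
- exact: semigroup_sum1 semiK _ _ t0.
Qed.

Lemma spin_mean_right_derivative i :
  has_right_derivative (fun t => spin_mean t ord0 i)
    (fun t => Pt t (L (coordinate i)) x0).
Proof.
under eq_fun do rewrite mxE.
exact: has_right_derivative_forward semiK _ _.
Qed.

Lemma spin_mean_drift i t : 0 <= t ->
  Pt t (L (coordinate i)) x0 <= drift i (spin_mean t).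
Proof.
move=> t0.
have l0 j x : 0 <= lambda0 j x.
  by rewrite -lambda_ext; exact/lambda_ge0/unit_cube_vertex.
have m0 j x : 0 <= mu0 j x.
  by rewrite -mu_ext; exact/mu_ge0/unit_cube_vertex.
have li j : config_increasing (lambda0 j).
  by move=> x y xy; rewrite -!lambda_ext; exact: increasing_vertex xy.
have md j : config_increasing (fun x => - mu0 j x).
  move=> x y xy; rewrite -!mu_ext.
  apply: (@increasing_vertex (fun z => - mu j z)) xy => a b ca cb ab.
  by rewrite lerN2; exact: mu_decr.
have si : config_increasing (fun x => lambda0 i x + mu0 i x).
  move=> x y xy; rewrite -!lambda_ext -!mu_ext.
  exact: (increasing_vertex (@sum_incr i)) xy.
have H := attractive_harris l0 m0 li md semiK x0 t0
  (@coordinate_increasing i) si.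
have Jl : Pt t (lambda0 i) x0 <= lambda i (spin_mean t).
  have := spin_mean_jensen (@lambda_concave i) t0.
  have -> : Pt t (fun y => - lambda i (vertex R y)) x0 = - Pt t (lambda0 i) x0.
    rewrite /kernel_apply -sumrN; apply: eq_bigr => y _.
    by rewrite lambda_ext mulrN.
  by rewrite lerN2.
have Jm : mu i (spin_mean t) <= Pt t (mu0 i) x0.
  have := spin_mean_jensen (@mu_convex i) t0.
  by under [X in _ <= X]eq_bigr do rewrite mu_ext.
have -> : Pt t (L (coordinate i)) x0 = Pt t (lambda0 i) x0 -
    Pt t (fun x => coordinate i x * (lambda0 i x + mu0 i x)) x0.
  by rewrite -kernel_applyB; apply: eq_bigr => y _; rewrite generator_coordinate.
have sumE : Pt t (fun x => lambda0 i x + mu0 i x) x0 =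
    Pt t (lambda0 i) x0 + Pt t (mu0 i) x0.
  by rewrite /kernel_apply -big_split; apply: eq_bigr => y _; rewrite mulrDr.
(* By Harris the derivative is at most (1 - q_i) E[lambda_i] - q_i E[mu_i]. As q_i lies in [0,1],
   both Jensen bounds can be inserted. *)
rewrite sumE in H; have := spin_mean_cube t0 i.
rewrite /mean_field_drift [spin_mean t ord0 i]mxE => /andP[q0 q1].
have A := ler_wpM2l q0 Jm.
have q1' : 0 <= 1 - Pt t (coordinate i) x0 by lra.
have B := ler_wpM2l q1' Jl.
lra.
Qed.

(** Below [b] no coordinate outside [b] can switch on, because its rate is at most the rate at [b],
    which is zero. A Gronwall-type barrier turns this into vanishing means. *)
Lemma spin_mean_eq0 (b : config n) : config_le x0 b ->
  (forall i, ~~ b i -> lambda0 i b = 0) ->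
  forall i t, 0 <= t -> ~~ b i -> spin_mean t ord0 i = 0.
Proof.
move=> x0b lb i t t0 bi.
have l0 j x : 0 <= lambda0 j x.
  by rewrite -lambda_ext; exact/lambda_ge0/unit_cube_vertex.
have m0 j x : 0 <= mu0 j x.
  by rewrite -mu_ext; exact/mu_ge0/unit_cube_vertex.
have li j : config_increasing (lambda0 j).
  by move=> x y xy; rewrite -!lambda_ext; exact: increasing_vertex xy.
pose C := \sum_j \sum_y lambda0 j y.
have C0 : 0 <= C by apply: sumr_ge0 => j _; apply: sumr_ge0.
have lC j y : lambda0 j y <= C.
  rewrite /C (bigD1 j) //= (bigD1 y) //= -addrA lerDl.
  by rewrite addr_ge0 // ?sumr_ge0 // => k _; apply: sumr_ge0.
(* Below [b] the rate vanishes by monotonicity; elsewhere some coordinate outside [b] equals [1],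
   and the crude bound [C] suffices. *)
have lle j y : ~~ b j ->
    lambda0 j y <= C * \sum_(k | ~~ b k) coordinate k y.
  move=> bj; have c0 k : 0 <= coordinate k y by rewrite /coordinate ler0n.
  have [yb|/config_leP] := boolP (config_le y b).
    apply: (le_trans (li _ _ _ yb)); rewrite lb //.
    by apply: mulr_ge0 => //; exact: sumr_ge0.
  move=> /existsNP [k /not_implyP [yk /negP bk]].
  apply: (le_trans (lC j y)); rewrite ler_peMr // (bigD1 k) //=.
  by rewrite {1}/coordinate yk lerDl sumr_ge0.
(* At most [n] coordinates contribute, each with mean at most [e * expR (k * s)]; the added [1]
   gives strictness. *)
pose k := C * n%:R + 1.
apply/eqP; rewrite eq_le; apply/andP; split; last first.
  by case/andP: (spin_mean_cube t0 i).
pose E := expR (k * t).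
have E0 : 0 < E by exact: expR_gt0.
suff key e : 0 < e -> spin_mean t ord0 i - e * E <= 0.
  rewrite leNgt; apply/negP => q0.
  have := key (spin_mean t ord0 i / (2 * E)) ltac:(by rewrite divr_gt0 // mulr_gt0).
  have -> : spin_mean t ord0 i / (2 * E) * E = spin_mean t ord0 i / 2.
    by field; rewrite gt_eqF.
  lra.
move=> e0.
pose g j s := spin_mean s ord0 j - e * expR (k * s).
pose d j s := Pt s (L (coordinate j)) x0 - e * (k * expR (k * s)).
apply: (@barrier R _ (fun j => ~~ b j) g d _ _ _ i t) => //.
- move=> j _; apply: has_right_derivativeB.
    exact: spin_mean_right_derivative.
  by apply: has_right_derivativeZ; exact: has_right_derivative_exp.
- move=> j bj; rewrite /g mulr0 expR0 mulr1 mxE (semigroup_apply0 semiK).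
  rewrite /coordinate; have := config_leP _ _ x0b j.
  by rewrite (negbTE bj); case: (x0 j) => [/(_ isT)//|_]; rewrite sub0r oppr_le0 ltW.
- move=> j s s0 bj H gj; rewrite /d subr_lt0.
  pose F := e * expR (k * s).
  have F0 : 0 < F by rewrite mulr_gt0 // expR_gt0.
  have -> : e * (k * expR (k * s)) = k * F by rewrite mulrCA.
  have H' l : ~~ b l -> spin_mean s ord0 l <= F.
    by move=> /H; rewrite /g -/F; lra.
  apply: (@le_lt_trans _ _ (C * (n%:R * F))); last by rewrite /k; lra.
  apply: (@le_trans _ _ (Pt s (fun y => C * \sum_(l | ~~ b l) coordinate l y) x0)).
    apply: (semigroup_apply_le semiK) => // y; rewrite generator_coordinate.
    apply: le_trans (lle j y bj); rewrite gerBl.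
    by rewrite mulr_ge0 ?ler0n // addr_ge0.
  have -> : Pt s (fun y => C * \sum_(l | ~~ b l) coordinate l y) x0 =
      C * \sum_(l | ~~ b l) spin_mean s ord0 l.
    rewrite /kernel_apply mulr_sumr.
    under eq_bigr do rewrite mulrCA mulr_sumr mulr_sumr.
    rewrite exchange_big /=; apply: eq_bigr => l _.
    by rewrite mxE mulr_sumr.
  apply: ler_wpM2l => //.
  apply: (@le_trans _ _ (\sum_(l < n) F)); last first.
    by rewrite sumr_const card_ord mulr_natl.
  rewrite big_mkcond /=; apply: ler_sum => l _.
  by case: ifP => [/H'//|_]; exact: ltW.
Qed.

End SpinMean.

(** * Comparison *)

Section Comparison.
Context (R : realType) (n : nat) (lambda0 mu0 : 'I_n -> config n -> R).
Context (lambda mu : 'I_n -> 'rV[R]_n -> R).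
Context (lambda_ext : forall i x, lambda i (vertex R x) = lambda0 i x).
Context (mu_ext : forall i x, mu i (vertex R x) = mu0 i x).
Context (lambda_ge0 : forall i x, unit_cube x -> 0 <= lambda i x).
Context (mu_ge0 : forall i x, unit_cube x -> 0 <= mu i x).
Context (lambda_incr : forall i, increasing_on_cube (lambda i)).
Context (lambda_concave : forall i, concave_on_cube (lambda i)).
Context (mu_decr : forall i, decreasing_on_cube (mu i)).
Context (mu_convex : forall i, convex_on_cube (mu i)).
Context (sum_incr : forall i, increasing_on_cube (fun x => lambda i x + mu i x)).
Context (K : R -> config n -> config n -> R).
Context (semiK : is_transition_semigroup (spin_rate lambda0 mu0) K).
Context (p : R -> 'rV[R]_n) (solp : is_mean_field_solution lambda mu p).
Context (x0 : config n) (p0 : forall i, p 0 ord0 i = (x0 i)%:R).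

Notation q := (spin_mean K x0).
Notation drift := (mean_field_drift lambda mu).
Notation B := (mean_field_support p).

(** Where p_i can vanish, a multiple of it leaves no strict room, so these coordinates are treated
    apart. The support vertex dominates [x0], and the rates of switching on outside it are zero
    there. *)
Lemma spin_mean_off_support i t : 0 <= t -> ~~ B i -> q t ord0 i = 0.
Proof.
move=> t0 Bi; apply: (spin_mean_eq0 lambda_ext mu_ext lambda_ge0 mu_ge0
  lambda_incr semiK (b := support_vertex p)) => //.
- apply/config_leP => j xj; rewrite ffunE; apply/asboolP => s s0.
  apply: (mean_field_gt0 lambda_ge0 mu_decr solp (lexx 0) (ltW s0)).
  by rewrite p0 xj ltr01.
- move=> j; rewrite ffunE => Bj; rewrite -lambda_ext.
  exact: (lambda_support_vertex lambda_ge0 lambda_incr lambda_concave mu_decr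
    solp Bj).
- by rewrite ffunE.
Qed.

(* The drift need not be Lipschitz near the faces of the cube, and [p] need not
   be the only solution. Comparing with the multiple [c p] for [c > 1]
   increasing in time makes the barrier strict; starting [p] at [u > 0]
   makes [p] positive on its support. *)
Lemma spin_mean_le_scaled (eta u t : R) i : 0 < eta -> 0 < u -> 0 <= t ->
  (forall j, x0 j -> 1 <= (1 + eta) * p u ord0 j) -> B i ->
  q t ord0 i <= (1 + eta * (1 + t)) * p (u + t) ord0 i.
Proof.
move=> eta0 u0 t0 pu Bi; rewrite -subr_le0.
pose c s := 1 + eta * (1 + s).
pose g j s := q s ord0 j - c s * p (u + s) ord0 j.
pose d j s := kernel_apply (K s)
    (kernel_apply (generator (spin_rate lambda0 mu0)) (coordinate R j)) x0 -
  ((0 + eta) * p (u + s) ord0 j + c s * drift j (p (u + s))).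
apply: (@barrier R _ B g d _ _ _ i t t0 Bi).
- move=> j Bj; apply: has_right_derivativeB.
    exact: spin_mean_right_derivative.
  apply: has_right_derivativeM;
    last exact: (mean_field_right_derivative solp _ (ltW u0)).
  apply: has_right_derivativeD; first exact: has_right_derivative_cst.
  exact: has_right_derivative_affine.
- move=> j Bj; rewrite /g /c !addr0 mulr1 mxE (semigroup_apply0 semiK).
  rewrite /coordinate subr_le0; have [xj|_] := boolP (x0 j); first exact: pu.
  have /andP[pj _] := mf_cube solp (ltW u0) j.
  by apply: mulr_ge0 => //; lra.
- move=> j s s0 Bj H gj; rewrite /d.
  have us : 0 < u + s by lra.
  have cp := mf_cube solp (ltW us).
  have cq := spin_mean_cube semiK x0 s0.
  have pj := mean_field_supportP Bj us.
  have es : 0 <= eta * (1 + s) by apply: mulr_ge0; lra.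
  have c1 : 1 <= c s by rewrite /c; lra.
  have D1 := spin_mean_drift lambda_ext mu_ext lambda_ge0 mu_ge0 lambda_incr
    lambda_concave mu_decr mu_convex sum_incr semiK x0 j s0.
  have D2 : drift j (q s) <= c s * drift j (p (u + s)).
    apply: (mean_field_drift_scale lambda_ge0 lambda_incr lambda_concave mu_decr
      sum_incr) => //.
      (* The scaling bound requires q <= c p in every coordinate: on the support the barrier
         provides it, off the support the mean is zero. *)
      move=> k; have [Bk|Bk] := boolP (B k).
        by have := H k Bk; rewrite /g; lra.
      rewrite spin_mean_off_support // mulr_ge0 //; first lra.
      by case/andP: (cp k).
    by move: gj; rewrite /g; lra.
  have : 0 < eta * p (u + s) ord0 j by exact: mulr_gt0.
  lra.
Qed.

Lemma spin_mean_le_mean_field i t : 0 <= t -> q t ord0 i <= p t ord0 i.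
Proof.
move=> t0; have /andP[pi0 pi1] := mf_cube solp t0 i.
have [Bi|Bi] := boolP (B i); last by rewrite spin_mean_off_support.
(* Since p_i <= 1, the factor [1 + eta * (1 + t)] costs at most [eta * (1 + t)], which vanishes with
   [eta]. *)
rewrite -subr_le0; apply: (le_forall_pos_scale t0) => eta eta0.
pose c := 1 + eta * (1 + t).
have et : 0 <= eta * (1 + t) by apply: mulr_ge0; lra.
suff H : q t ord0 i <= c * p t ord0 i.
  have : eta * (1 + t) * p t ord0 i <= eta * (1 + t) by rewrite ler_piMr.
  by move: H; rewrite /c; lra.
(* A strict violation persists by right continuity when [p] is started at a small [u > 0]. The
   initial condition of the scaled bound also holds then, as p_j(0) = 1 exceeds 1 / (1 + eta) where
   [x0 j]. The two contradict each other. *)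
rewrite leNgt; apply/negP => cpq.
have R0 j := right_continuity (mean_field_right_derivative solp j (lexx 0)).
have near_p0 : \forall u \near (0 : R)^'+,
    forall j, x0 j -> 1 <= (1 + eta) * p u ord0 j.
  rewrite near_withinE /=.
  have N j : \forall u \near (0 : R), 0 < u -> x0 j ->
      1 <= (1 + eta) * p u ord0 j.
    have [xj|_] := boolP (x0 j); last by near=> u.
    have := R0 j 0 (lexx 0); rewrite addr0 p0 xj.
    under eq_fun do rewrite !add0r.
    have e1 : (1 + eta)^-1 < 1 by rewrite invf_lt1; lra.
    move=> /cvgr_gt /(_ _ e1); rewrite near_withinE /=.
    apply: filterS => u + u0 _ => /(_ u0) /ltW.
    by rewrite -[_^-1]mulr1 ler_pdivrMl //; lra.
  by apply: filterS (filter_forall _ N) => u A u0 j; exact: A.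
have near_pt : \forall u \near (0 : R)^'+, c * p (u + t) ord0 i < q t ord0 i.
  have := R0 i t t0; rewrite add0r; under eq_fun do rewrite add0r addrC.
  move=> /(cvgM (cvg_cst c)) /cvgr_lt; exact.
have : \forall u \near (0 : R)^'+, False.
  near=> u.
  have u0 : 0 < u by near: u; exact: nbhs_right_gt.
  have A : forall j, x0 j -> 1 <= (1 + eta) * p u ord0 j by near: u.
  have : c * p (u + t) ord0 i < q t ord0 i by near: u.
  by apply/negP; rewrite -leNgt; exact: spin_mean_le_scaled.
by move=> /filter_ex [].
Unshelve. all: by end_near. Qed.

End Comparison.

(** The Markov property at time [0], with the whole space as past event, gives P(X_0 = x0, X_t = y)
    = P(X_0 = x0) K_t(x0, y). Summing over the [y] with [y i] and dividing by P(X_0 = x0) yields the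
    mean under [K]. *)
Lemma cond_expectation_coordinate (R : realType) (n : nat) (d : measure_display)
    (T : measurableType d) (P : probability T R)
    (X : R -> T -> config n) (K : R -> config n -> config n -> R)
    (x0 : config n) (i : 'I_n) (t : R) :
  (forall (t : R) x, 0 <= t -> measurable (X t @^-1` [set x])) ->
  (forall (t h : R) A x y, 0 <= t -> 0 <= h -> past X t A ->
    P (A `&` X t @^-1` [set x] `&` X (t + h) @^-1` [set y]) =
    (P (A `&` X t @^-1` [set x]) * (K h x y)%:E)%E) ->
  (0 < P (X 0%R @^-1` [set x0]))%E -> 0 <= t ->
  cond_expectation P (X 0%R @^-1` [set x0]) (fun w => (X t w i)%:R) =
    spin_mean K x0 t ord0 i.
Proof.
move=> mX markov P0 t0; set A := X 0 @^-1` [set x0].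
have mA : measurable A by exact: mX.
pose F y := A `&` X t @^-1` [set y].
have PF y : P (F y) = (P A * (K t x0 y)%:E)%E.
  have := markov 0 t setT x0 y (lexx 0) t0; rewrite add0r !setTI; apply.
  by rewrite -(setD0 setT); apply: sigma_algebraCD; exact: sigma_algebra0.
(* The integrand is the indicator of a finite disjoint union, so its expectation is a finite sum of
   the probabilities [PF]. *)
have E1 : (fun w => (X t w i)%:R * \1_A w) =
    \1_(\bigcup_(y in [set` (fun y : config n => y i)]) F y) :> (T -> R).
  apply/funext => w; rewrite !indicE -natrM mulnb; congr (_%:R); congr nat_of_bool.
  apply/idP/idP.
    move=> /andP[Xi]; rewrite !inE => Aw; exists (X t w) => //.
  rewrite !inE => -[y yi [Aw ->]]; have -> : y i by exact: yi.
  exact/mem_set.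
have mF y : measurable (F y) by apply: measurableI => //; exact: mX.
rewrite /cond_expectation E1 expectation_indic; last first.
  by apply: fin_bigcup_measurable => // y _; exact: mF.
rewrite measure_fin_bigcup //; last first.
  move=> y z _ _ [w [[_ yw] [_ zw]]]; exact: etrans (esym yw) zw.
rewrite -(@bigfs _ _ _ _ (index_enum (config n))) /=; last 2 first.
- exact: index_enum_uniq.
- by move=> y _; rewrite mem_index_enum.
have PA : P A \is a fin_num by exact: fin_num_measure.
rewrite (eq_bigr (fun y => (fine (P A) * K t x0 y)%:E)); last first.
  by move=> y _; rewrite PF EFinM fineK.
rewrite sumEFin /= -mulr_sumr mulrAC divff ?mul1r; last first.
  by rewrite gt_eqF // fine_gt0 // P0 /= ltey_eq PA.
rewrite mxE /kernel_apply big_mkcond; apply: eq_bigr => y _.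
by rewrite /coordinate; case: (y i); rewrite ?mulr1 ?mulr0.
Qed.

Unset Implicit Arguments.

Theorem theorem2p2 (R : realType) (n : nat) (n_gt0 : (0 < n)%N)
    (d : measure_display) (T : measurableType d) (P : probability T R)
    (lambda0 mu0 : 'I_n -> config n -> R)
    (lambda0_ge0 : forall i x, 0 <= lambda0 i x)
    (mu0_ge0 : forall i x, 0 <= mu0 i x)
    (X : R -> T -> config n) (spinX : is_spin_system P lambda0 mu0 X)
    (lambda mu : 'I_n -> 'rV[R]_n -> R)
    (lambda_ext : forall i x, lambda i (vertex R x) = lambda0 i x)
    (mu_ext : forall i x, mu i (vertex R x) = mu0 i x)
    (lambda_ge0 : forall i x, unit_cube x -> 0 <= lambda i x)
    (mu_ge0 : forall i x, unit_cube x -> 0 <= mu i x)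
    (lambda_incr : forall i, increasing_on_cube (lambda i))
    (lambda_concave : forall i, concave_on_cube (lambda i))
    (mu_decr : forall i, decreasing_on_cube (mu i))
    (mu_convex : forall i, convex_on_cube (mu i))
    (sum_incr : forall i, increasing_on_cube (fun x => lambda i x + mu i x))
    (p : R -> 'rV[R]_n) (solp : is_mean_field_solution lambda mu p)
    (x0 : config n) (x0_gt0 : (0 < P (X 0%R @^-1` [set x0]))%E)
    (p0 : forall i, p 0 ord0 i = (x0 i)%:R) :
  forall (i : 'I_n) (t : R), 0 <= t ->
    cond_expectation P (X 0%R @^-1` [set x0]) (fun w => (X t w i)%:R)
      <= p t ord0 i.
Proof.
case: spinX => mX _ _ [K semiK markov] i t t0.
rewrite (cond_expectation_coordinate i mX markov x0_gt0 t0).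
exact: (spin_mean_le_mean_field lambda_ext mu_ext lambda_ge0 mu_ge0 lambda_incr
  lambda_concave mu_decr mu_convex sum_incr semiK solp p0).
Qed.
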